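(* Let $B_J\in\mathbb R^{n\times n}$ be irreducible with $B_J\ge O$ elementwise and $\rho(B_J)>0$. Let $\mathcal B$ and $\mathcal B'$ be splittings of $B_J$ of orders $d\ge1$ and $d+1$ (for $d=1$, $\mathcal B=(B_J)$) with $\mathcal B'\succ\mathcal B$. Then: (d1) if $\rho(B_J)<1$ then $\rho(T(\mathcal B'))<\rho(T(\mathcal B))\le\rho(B_J)$; (d2) if $\rho(B_J)=1$ then $\rho(T(\mathcal B'))=\rho(T(\mathcal B))=1$; (d3) if $\rho(B_J)>1$ then $\rho(T(\mathcal B'))>\rho(T(\mathcal B))\ge\rho(B_J)$.
   Context: For $B\in\mathbb R^{n\times n}$, a splitting of $B$ of order $d\ge1$ is an ordered $d$-tuple $\mathcal B=(B_1,\dots,B_d)$ of real $n\times n$ matrices with $B_p\neq O$ for all $p$, $\sum_{p=1}^d B_p=B$, and $B_p\circ B_q=O$ (Hadamard product) for $p\ne q$. The iteration matrix of $\mathcal B$ is the $dn\times dn$ matrix $T(\mathcal B)=(I_{dn}-\mathcal L)^{-1}\mathcal U$, where $\mathcal L,\mathcal U$ are $d\times d$ block matrices with $n\times n$ blocks, $\mathcal L_{ij}=B_j$ if $i>j$ and $O$ otherwise, $\mathcal U_{ij}=B_j$ if $i\le j$ and $O$ otherwise (so $T((B_J))=B_J$). The cyclic shift is $\mathcal S(B_1,\dots,B_d)=(B_d,B_1,\dots,B_{d-1})$, $\mathcal S^r$ its $r$-fold iterate. For splittings $\mathcal B$ of order $d$ and $\mathcal B'$ of order $d+1$ of the same matrix,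 $\mathcal B'\succ\mathcal B$ (refinement) means there exist integers $0\le r\le d-1$, $0\le s\le d$ such that, with $(C_1,\dots,C_d)=\mathcal S^r(\mathcal B)$ and $(C'_1,\dots,C'_{d+1})=\mathcal S^s(\mathcal B')$: (I) $C'_p=C_p$ for $p=1,\dots,d-1$; (II) $(C'_d,C'_{d+1})$ is a splitting of $C_d$; (III) $C'_{d+1}C'_d\ne O$. $\rho$ denotes spectral radius. *)

(* Defs.v *)
From HB Require Import structures.
From mathcomp Require Import all_boot all_order all_algebra.
From mathcomp Require Import complex.
From mathcomp Require Import classical_sets reals.
Set Implicit Arguments. Unset Strict Implicit. Unset Printing Implicit Defensive.
Import Order.TTheory GRing.Theory Num.Theory.
Local Open Scope ring_scope.
Local Open Scope complex_scope.

Section Defs.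
Variable R : realType.

Definition nonneg_mx n (A : 'M[R]_n) : Prop := forall i j, 0 <= A i j.

(* irreducibility: A is reducible iff there is a nonempty proper subset S of
   indices with A i j = 0 for all i in S, j not in S (i.e. A is permutationally
   similar to a block triangular matrix).  Irreducible = not reducible. *)
Definition irreducible_mx n (A : 'M[R]_n) : Prop :=
  forall S : {set 'I_n}, S != finset.set0 -> S != finset.setT ->
    exists i j, [/\ i \in S, j \notin S & A i j != 0].

Definition spectral_radius n (A : 'M[R]_n) : R :=
  sup [set r : R | exists l : R[i],
         eigenvalue (map_mx (fun x : R => x%:C) A) l /\ r%:C = `|l|].

Definition hadamard m n (A B : 'M[R]_(m, n)) : 'M[R]_(m, n) :=
  map2_mx (fun x y => x * y) A B.

Definition splitting n (B : 'M[R]_n) (s : seq 'M[R]_n) : Prop :=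
  [/\ forall p, (p < size s)%N -> s`_p != 0,
      \sum_(M <- s) M = B &
      forall p q, (p < size s)%N -> (q < size s)%N -> p != q ->
        hadamard s`_p s`_q = 0].

Definition blockL n (s : seq 'M[R]_n) : 'M[R]_(\sum_(i < size s) n) :=
  \mxblock_(i < size s, j < size s)
     ((if (j < i)%N then s`_j else 0) : 'M[R]_n).

Definition blockU n (s : seq 'M[R]_n) : 'M[R]_(\sum_(i < size s) n) :=
  \mxblock_(i < size s, j < size s)
     ((if (i <= j)%N then s`_j else 0) : 'M[R]_n).

Definition iteration_matrix n (s : seq 'M[R]_n) : 'M[R]_(\sum_(i < size s) n) :=
  invmx (1%:M - blockL s) *m blockU s.

Definition cshift n (s : seq 'M[R]_n) : seq 'M[R]_n := rotr 1 s.

(* refinement s' > s  (size s = d, size s' = d+1); 0-indexed positions *)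
Definition refines n (s' s : seq 'M[R]_n) : Prop :=
  exists r t : nat, [/\ (r <= (size s).-1)%N, (t <= size s)%N &
    let C := iter r (@cshift n) s in
    let C' := iter t (@cshift n) s' in
    let d := size s in
    [/\ forall p, (p < d.-1)%N -> C'`_p = C`_p,
        splitting C`_(d.-1) [:: C'`_(d.-1); C'`_d] &
        C'`_d *m C'`_(d.-1) != 0]].

End Defs.

(* Main.v *)
(* A nonzero vector x = (x_1, ..., x_d) satisfies T(B) x = mu x iff
     sum_j c_ij(mu) B_j x_j = mu x_i,   c_ij(mu) = mu if j < i and 1 otherwise,
   so write resid_i(mu, x) for the difference of the two sides.  If u >= 0 is a
   left Perron vector of T(B) and v = u (I - L)^-1 >= 0, then
     (rho(T(B)) - mu) u.x = sum_i v_i . resid_i(mu, x),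
   so the sign of the residual of a positive x locates rho(T(B)) relative to mu.
   Taking all x_i equal to the Perron vector of B_J compares rho(T(B)) with
   rho(B_J).  For the refinement, after shifting cyclically so that the last
   block C_d is split as E + F with F E <> 0, take the Perron vector x of T(C)
   for lambda = rho(T(C)) and extend it by x_{d+1} = x_d + (1 - 1/lambda) E x_d:
   the residual of the refined system is then (1 - 1/lambda) F E x_d in every
   block, and sum_i v_i > 0 by irreducibility, which gives the strict
   inequalities according to the sign of 1 - 1/lambda. *)

Require Import Defs.
From HB Require Import structures.
From mathcomp Require Import all_boot all_order all_algebra.
From mathcomp Require Import complex.
From mathcomp Require Import classical_sets reals.
From mathcomp Require Import topology normedtype derive.
Set Implicit Arguments. Unset Strict Implicit. Unset Printing Implicit Defensive.
Import Order.TTheory GRing.Theory Num.Theory.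
Import numFieldNormedType.Exports.
Local Open Scope ring_scope.

(** * Weak Perron-Frobenius theorem *)

Definition nonneg_row (R : realType) N (x : 'rV[R]_N) := forall i, 0 <= x 0 i.

Definition stochastic (R : realType) N (x : 'rV[R]_N) :=
  nonneg_row x /\ \sum_i x 0 i = 1.

Lemma nonneg_row_sum_gt0 (R : realType) N (x : 'rV[R]_N) :
  nonneg_row x -> x != 0 -> 0 < \sum_i x 0 i.
Proof.
move=> x0 xn0; rewrite lt_def sumr_ge0 ?andbT //.
apply: contra xn0 => /eqP/psumr_eq0P s0; apply/eqP/rowP => i.
by rewrite mxE s0.
Qed.

Lemma stochastic_normalize (R : realType) N (x : 'rV[R]_N) :
  nonneg_row x -> x != 0 -> stochastic ((\sum_i x 0 i)^-1 *: x).
Proof.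
move=> x0 xn0; have s0 := nonneg_row_sum_gt0 x0 xn0; split=> [i|].
  by rewrite mxE mulr_ge0 // invr_ge0 ltW.
under eq_bigr do rewrite mxE.
by rewrite -mulr_sumr mulVf // gt_eqF.
Qed.

Lemma stochastic_neq0 (R : realType) N (x : 'rV[R]_N) : stochastic x -> x != 0.
Proof.
move=> [_ x1]; apply/eqP => x0; move: x1; rewrite x0.
under eq_bigr do rewrite mxE.
by rewrite big1 // => /eqP; rewrite eq_sym oner_eq0.
Qed.

Lemma nonneg_rowM (R : realType) N M (x : 'rV[R]_N) (A : 'M[R]_(N, M)) :
  nonneg_row x -> (forall i j, 0 <= A i j) -> nonneg_row (x *m A).
Proof. by move=> x0 A0 j; rewrite mxE sumr_ge0 // => i _; rewrite mulr_ge0. Qed.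

(** * Closedness and compactness of the simplex times an interval *)

Lemma closed_ge0_preimage (R : realType) (T : topologicalType) (f : T -> R) :
  continuous f -> closed [set p | 0 <= f p]%classic.
Proof.
move=> cf; apply: (preimage_closed (f := f) (D := [set x | 0 <= x]%classic)).
  by move=> x _; exact: cf.
exact: closed_ge.
Qed.

Lemma continuous_sumr (R : realType) (T : topologicalType) (I : finType)
    (F : I -> T -> R) :
  (forall i, continuous (F i)) -> continuous (fun p => \sum_i F i p).
Proof.
move=> cF; apply: continuous_big => [|i _]; last exact: cF.
exact: add_continuous.
Qed.

Lemma fst_coord_continuous (R : realType) N j :
  continuous (fun p : 'rV[R]_N * R => p.1 0 j).
Proof.
move=> p; apply: (@continuous_comp _ _ _ (fun p : 'rV[R]_N * R => p.1)
  (fun M : 'rV[R]_N => M 0 j)).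
  exact: cvg_fst.
exact: coord_continuous.
Qed.

Lemma snd_real_continuous (R : realType) N :
  continuous (fun p : 'rV[R]_N * R => p.2).
Proof. by move=> p; exact: cvg_snd. Qed.

Lemma eigen_defect_continuous (R : realType) N (A : 'M[R]_N) j :
  continuous (fun p : 'rV[R]_N * R => (p.1 *m A) 0 j - p.2 * p.1 0 j).
Proof.
have -> : (fun p : 'rV[R]_N * R => (p.1 *m A) 0 j - p.2 * p.1 0 j) =
          (fun p => \sum_i p.1 0 i * A i j - p.2 * p.1 0 j).
  by apply: boolp.funext => p; rewrite mxE.
move=> p; apply: cvgB.
  apply: continuous_sumr => i q.
  apply: cvgM; [exact: fst_coord_continuous | exact: cvg_cst].
by apply: cvgM; [exact: snd_real_continuous | exact: fst_coord_continuous].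
Qed.

(** The set is a closed part of a cube times a segment; the condition of sum 1 enters as two closed
    inequalities. *)
Lemma stochastic_box_compact (R : realType) N (a b : R) :
  compact [set p : 'rV[R]_N * R | stochastic p.1 /\ a <= p.2 <= b]%classic.
Proof.
have cbox := compact_setX
  (rV_compact (fun _ : 'I_N => @segment_compact R 0 1))
  (@segment_compact R a b).
pose s (p : 'rV[R]_N * R) := \sum_i p.1 0 i.
have cs : continuous s by apply: continuous_sumr => i; exact: fst_coord_continuous.
have c1 : closed [set p : 'rV[R]_N * R | 0 <= s p - 1]%classic.
  apply: closed_ge0_preimage => p; apply: cvgB; first exact: cs.
  exact: cvg_cst.
have c2 : closed [set p : 'rV[R]_N * R | 0 <= 1 - s p]%classic.
  apply: closed_ge0_preimage => p; apply: cvgB; last exact: cs.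
  exact: cvg_cst.
have := compact_closedI (compact_closedI cbox c1) c2.
congr compact; apply/seteqP; split => -[x r] /=; rewrite /s /= ?subr_ge0.
  move=> [[[xb rb] s1] s2]; split; last by move: rb; rewrite in_itv.
  split; last by apply/eqP; rewrite eq_le s1 s2.
  by move=> i; have := xb i; rewrite in_itv /= => /andP[].
move=> [[x0 sx] rb]; split; last by rewrite sx.
split; last by rewrite sx.
split; last by rewrite /= in_itv.
move=> i /=; rewrite in_itv /= x0 /= -sx (bigD1 i) //= lerDl sumr_ge0 //.
Qed.

(** * Perron vectors of positive and of nonnegative matrices *)

Lemma fin_pos_lower_bound (R : realType) N (f : 'I_N -> R) :
  (forall i, 0 < f i) -> exists2 d, 0 < d & forall i, d <= f i.
Proof.
case: N f => [|N] f f0; first by exists 1 => // -[].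
case: (@arg_minP _ _ _ ord0 xpredT f isT) => i _ fi; exists (f i) => // j.
exact: fi.
Qed.

(** Sum the inequalities over [j] and use [x 0 i <= 1]. The bound keeps the admissible [mu] in a
    compact interval. *)
Lemma subinvariance_bound (R : realType) N (A : 'M[R]_N) x mu :
  nonneg_mx A -> stochastic x -> (forall j, mu * x 0 j <= (x *m A) 0 j) ->
  mu <= \sum_i \sum_j A i j.
Proof.
move=> A0 [x0 x1] h; rewrite -[mu]mulr1 -x1 mulr_sumr.
apply: (le_trans (ler_sum _ (fun j _ => h j))).
under eq_bigr do rewrite mxE.
rewrite exchange_big /=; apply: ler_sum => i _; apply: ler_sum => j _.
rewrite ler_piMl // -x1 (bigD1 i) //= lerDl sumr_ge0 //.
Qed.

(** Collatz-Wielandt argument: by compactness some pair with [x] stochastic and [mu x <= x A] has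
    [mu] maximal, and a maximizer that is not an eigenvector could be improved. The last clause
    keeps the maximality, which later bounds the moduli of eigenvalues. *)
Lemma perron_pos (R : realType) N (A : 'M[R]_N) :
  (0 < N)%N -> (forall i j, 0 < A i j) ->
  exists x r, [/\ stochastic x, 0 <= r, x *m A = r *: x &
    forall z mu, nonneg_row z -> z != 0 -> 0 <= mu ->
      (forall j, mu * z 0 j <= (z *m A) 0 j) -> mu <= r].
Proof.
move=> N0 Ap; have A0 : nonneg_mx A by move=> i j; exact: ltW.
pose b := \sum_i \sum_j A i j.
pose K := [set p : 'rV[R]_N * R | stochastic p.1 /\ 0 <= p.2 <= b]%classic.
pose D := [set p : 'rV[R]_N * R |
  forall j, 0 <= (p.1 *m A) 0 j - p.2 * p.1 0 j]%classic.
have cD : closed D.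
  have -> : D = (\bigcap_(j in [set: 'I_N])
      [set p : 'rV[R]_N * R | 0 <= (p.1 *m A) 0 j - p.2 * p.1 0 j])%classic.
    by apply/seteqP; split=> p h j; [move=> _; exact: h | exact: (h j I)].
  apply: closed_bigI => j _; apply: closed_ge0_preimage.
  exact: eigen_defect_continuous.
have KD z mu : nonneg_row z -> z != 0 -> 0 <= mu ->
    (forall j, mu * z 0 j <= (z *m A) 0 j) ->
    (K `&` D)%classic ((\sum_i z 0 i)^-1 *: z, mu).
  move=> z0 zn0 mu0 h; have st := stochastic_normalize z0 zn0.
  have s0 := nonneg_row_sum_gt0 z0 zn0.
  have h' j : mu * ((\sum_i z 0 i)^-1 *: z) 0 j <=
              ((\sum_i z 0 i)^-1 *: z *m A) 0 j.
    by rewrite -scalemxAl !mxE mulrCA ler_pM2l ?invr_gt0 //; have := h j; rewrite mxE.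
  split=> /=; last by move=> j /=; rewrite subr_ge0.
  by split=> //; rewrite mu0 /=; apply: subinvariance_bound h'.
have cKD := compact_closedI (@stochastic_box_compact R N 0 b) cD.
have KD0 : (K `&` D !=set0)%classic.
  have z0 : nonneg_row (const_mx 1 : 'rV[R]_N) by move=> i; rewrite mxE.
  have zn0 : (const_mx 1 : 'rV[R]_N) != 0.
    by apply/eqP => /rowP/(_ (Ordinal N0))/eqP; rewrite !mxE oner_eq0.
  eexists; apply: (KD _ 0 z0 zn0) => // j.
  by rewrite mul0r; apply: nonneg_rowM.
have [[x r]] := compact_EVT_max KD0 cKD
  (continuous_subspaceT (@snd_real_continuous R N)).
rewrite inE /= => -[[/= sx /andP[r0 rb]] xr] maxr.
have maxr' z mu : nonneg_row z -> z != 0 -> 0 <= mu ->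
    (forall j, mu * z 0 j <= (z *m A) 0 j) -> mu <= r.
  by move=> z0 zn0 mu0 /(KD _ _ z0 zn0 mu0) h; exact: (maxr (_, mu) (mem_set h)).
exists x, r; split => //.
(* If the defect [x A - r x] is nonzero, one more factor [A] makes it strictly positive, so [x A]
   admits [r + d] for some [d > 0]. *)
apply/eqP; rewrite -subr_eq0; apply/negP => /negP dn0.
have d0 : nonneg_row (x *m A - r *: x).
  by move=> j; have := xr j; rewrite !mxE.
have posA z : nonneg_row z -> z != 0 -> forall j, 0 < (z *m A) 0 j.
  move=> z0 zn0 j; rewrite mxE.
  have [d dp dA] := fin_pos_lower_bound (fun i => Ap i j).
  apply: (@lt_le_trans _ _ (\sum_i z 0 i * d)).
    by rewrite -mulr_suml mulr_gt0 // nonneg_row_sum_gt0.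
  by apply: ler_sum => i _; rewrite ler_wpM2l.
have y0 := posA _ sx.1 (stochastic_neq0 sx).
have e0 := posA _ d0 dn0.
have [d dp dle] := fin_pos_lower_bound
  (fun j => divr_gt0 (e0 j) (y0 j)).
suff : r + d <= r by rewrite gerDl leNgt dp.
apply: (maxr' (x *m A)).
- by move=> j; rewrite ltW.
- by apply/eqP => h; have := y0 (Ordinal N0); rewrite h mxE ltxx.
- by rewrite addr_ge0 // ltW.
move=> j; have := dle j; rewrite ler_pdivlMr // mulmxBl -scalemxAl.
by rewrite mulrDl -lerBrDl [leRHS]mxE [X in _ + X]mxE [X in - X]mxE.
Qed.

(** [eigenvalue] refers to left eigenvectors: take the moduli of the entries of one and apply the
    triangle inequality in each column. *)
Lemma eigenvalue_norm_subinvariant (R : realType) N (A : 'M[R]_N) (l : R[i]) r :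
  nonneg_mx A -> eigenvalue (map_mx (fun x : R => x%:C%C) A) l ->
  (r%:C)%C = `|l| ->
  exists a : 'rV[R]_N, [/\ nonneg_row a, a != 0, 0 <= r &
    forall j, r * a 0 j <= (a *m A) 0 j].
Proof.
move=> A0 /eigenvalueP [z zA zn0] rl.
exists (\row_i Normc.normc (z 0 i)); split.
- by move=> i; rewrite mxE; case: (z 0 i) => p q; rewrite sqrtr_ge0.
- apply: contra zn0 => /eqP/rowP a0; apply/eqP/rowP => i.
  by have := a0 i; rewrite !mxE => /Normc.eq0_normc.
- by rewrite -lecR rl; exact: normr_ge0.
move=> j; rewrite -lecR rmorphM /= rl mxE.
have -> : (Normc.normc (z 0 j))%:C%C = `|z 0 j| by [].
rewrite -normrM; have := congr1 (fun y : 'rV_N => y 0 j) zA.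
rewrite !mxE => <-; apply: (le_trans (ler_norm_sum _ _ _)).
rewrite rmorph_sum /=; apply: ler_sum => i _.
have Aij : `|(A i j)%:C%C| = (A i j)%:C%C :> R[i] by rewrite ger0_norm // lecR.
by rewrite normrM rmorphM /= !mxE Aij.
Qed.

(* Perturb A into the positive matrices A + e; by compactness the defect of
   their Perron vectors reaches 0, and A-eigenvalues never exceed their Perron
   roots. *)
Lemma perron_frobenius (R : realType) N (A : 'M[R]_N) :
  (0 < N)%N -> nonneg_mx A ->
  exists x : 'rV[R]_N,
    [/\ nonneg_row x, x != 0 & x *m A = spectral_radius A *: x].
Proof.
move=> N0 A0; rewrite /spectral_radius; set E := [set r : R | _]%classic.
(* Since [e <= 1], this bounds the Perron roots of all the matrices [A + e] at once. *)
pose b := \sum_i \sum_j (A i j + 1).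
have approx (e : R) : 0 < e <= 1 -> exists x r, [/\ stochastic x,
    0 <= r <= b, x *m A = r *: x - const_mx e & ubound E r].
  move=> /andP[e0 e1].
  have Ae0 i j : 0 < (A + const_mx e) i j by rewrite !mxE ltr_wpDl.
  have [x [r [sx r0 xr rmax]]] := perron_pos N0 Ae0.
  exists x, r; split => //.
  - rewrite r0 /=; apply: (@le_trans _ _ (\sum_i \sum_j (A + const_mx e) i j)).
      apply: (@subinvariance_bound _ _ _ x).
      + by move=> i j; exact: ltW.
      + exact: sx.
      + by move=> j; rewrite xr mxE.
    by apply: ler_sum => i _; apply: ler_sum => j _; rewrite !mxE lerD2l.
  - rewrite -xr mulmxDr.
    suff -> : x *m (const_mx e : 'M_N) = const_mx e by rewrite addrK.
    apply/rowP => j; rewrite !mxE; under eq_bigr do rewrite mxE.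
    by rewrite -mulr_suml sx.2 mul1r.
  move=> s [l [el sl]].
  have [a [a0 an0 s0 sa]] := eigenvalue_norm_subinvariant A0 el sl.
  apply: (rmax a) => // j; apply: le_trans (sa j) _.
  rewrite mulmxDr [leRHS]mxE lerDl; apply: nonneg_rowM => // i k.
  by rewrite mxE ltW.
(* [sup] of the empty set is 0, hence the condition [0 <= r]. *)
have supE r : 0 <= r -> ubound E r -> sup E <= r.
  move=> r0 ub; have [->|/set0P En0] := eqVneq E (set0 : set R); first by rewrite sup0.
  exact: ge_sup.
(* The lower bound [sup E] is built into [K], so the minimizer of the defect has second coordinate
   at least [sup E]. *)
pose K := [set p : 'rV[R]_N * R | stochastic p.1 /\ sup E <= p.2 <= b]%classic.
pose f (p : 'rV[R]_N * R) := \sum_j `|(p.1 *m A) 0 j - p.2 * p.1 0 j|.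
have cf : continuous f.
  apply: continuous_sumr => j p.
  by apply: cvg_norm; exact: eigen_defect_continuous.
have fK (e : R) : 0 < e <= 1 -> exists2 p, K p & f p = N%:R * e.
  move=> he; have [x [r [sx /andP[r0 rb] xr ub]]] := approx e he.
  exists (x, r); first by split; rewrite //= supE.
  rewrite /f /= xr; under eq_bigr => j _.
    rewrite !mxE addrAC subrr add0r normrN gtr0_norm; last by case/andP: he.
    over.
  by rewrite sumr_const card_ord mulr_natl.
have bd1 : 0 < (1 : R) <= 1 by rewrite ltr01 lexx.
have K0 : (K !=set0)%classic by have [p Kp _] := fK 1 bd1; exists p.
have [[x r]] := compact_EVT_min K0 (@stochastic_box_compact R N (sup E) b)
  (continuous_subspaceT cf).
rewrite inE => -[/= sx /andP[Er rb]] minf.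
have f0 : f (x, r) = 0.
  apply/eqP; rewrite eq_le; apply/andP; split; last exact: sumr_ge0.
  rewrite leNgt; apply/negP => fp.
  (* With this [e] the attained defect [N e] is at most [N / (N + 1)] times [f (x, r)], against
     minimality. *)
  pose e := Num.min 1 (f (x, r) / N.+1%:R).
  have he : 0 < e <= 1 by rewrite lt_min ltr01 divr_gt0 ?ltr0n // ge_min lexx.
  have [p Kp fp'] := fK e he.
  have := minf p (mem_set Kp); rewrite fp' leNgt => /negP; apply.
  apply: (@le_lt_trans _ _ (N%:R * (f (x, r) / N.+1%:R))).
    by rewrite ler_wpM2l ?ler0n // ge_min lexx orbT.
  by rewrite mulrA ltr_pdivrMr ?ltr0n // mulrC ltr_pM2l // ltr_nat.
have xn0 := stochastic_neq0 sx.
have xr : x *m A = r *: x.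
  apply/rowP => j; rewrite [RHS]mxE; apply/eqP; rewrite -subr_eq0 -normr_eq0.
  by move/psumr_eq0P : f0 => ->.
exists x; split => //; first exact: sx.1.
suff -> : sup E = r by [].
(* As [r] is an eigenvalue, the chain [sup E <= r <= |r| <= sup E] closes. *)
have rE : E `|r|.
  exists (r%:C)%C; split; last by rewrite normc_def /= expr0n addr0 sqrtr_sqr.
  apply/eigenvalueP; exists (map_mx (fun x : R => x%:C%C) x).
    rewrite -map_mxM xr; apply/rowP => j; rewrite !mxE; exact: rmorphM.
  apply: contra xn0 => /eqP/rowP h; apply/eqP/rowP => j.
  by have := h j; rewrite !mxE => -[].
have hE : `|r| <= sup E.
  by have [_ [r1 [_ _ _ ub1]]] := approx 1 bd1; apply: ub_le_sup => //; exists r1.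
apply/eqP; rewrite eq_le Er /=; apply: le_trans (ler_norm r) hE.
Qed.

(** Both matrices have the same characteristic polynomial. Right Perron vectors are thus obtained as
    left ones of the transpose. *)
Lemma eigenvalue_tr (F : fieldType) N (A : 'M[F]_N) l :
  eigenvalue A^T l = eigenvalue A l.
Proof.
rewrite !eigenvalue_root_char; congr (root _ l).
rewrite /char_poly -det_tr /char_poly_mx; congr (\det _).
by rewrite linearB /= tr_scalar_mx -map_trmx trmxK.
Qed.

Lemma spectral_radius_tr (R : realType) N (A : 'M[R]_N) :
  spectral_radius A^T = spectral_radius A.
Proof.
pose S (p : pred R[i]) :=
  sup [set r : R | exists l, p l /\ (r%:C)%C = `|l|]%classic.
suff e : eigenvalue (map_mx (fun x : R => x%:C%C) A^T) =
         eigenvalue (map_mx (fun x : R => x%:C%C) A).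
  exact: (congr1 S e).
by apply: boolp.funext => l; rewrite -map_trmx; exact: eigenvalue_tr.
Qed.

(** * Block structure of the iteration matrix *)

Definition mx_ge0 (R : realType) m n (A : 'M[R]_(m, n)) := forall i j, 0 <= A i j.

Lemma mx_ge0M (R : realType) m n p (A : 'M[R]_(m, n)) (B : 'M[R]_(n, p)) :
  mx_ge0 A -> mx_ge0 B -> mx_ge0 (A *m B).
Proof.
by move=> A0 B0 i j; rewrite mxE sumr_ge0 // => k _; rewrite mulr_ge0.
Qed.

Lemma mxcol_ge0P (R : realType) d n m (x : 'I_d -> 'M[R]_(n, m)) :
  mx_ge0 (\mxcol_(i < d) x i) <-> forall i, mx_ge0 (x i).
Proof.
split=> x0; last by move=> a b; rewrite mxE; exact: x0.
move=> i a b; suff -> : x i a b = (\mxcol_j x j) (tagnat.Rank i a) b by [].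
by rewrite -[in LHS](mxcolK x i) [LHS]mxE.
Qed.

Definition mx_gt0 (R : realType) m n (A : 'M[R]_(m, n)) := forall i j, 0 < A i j.

Section Blocks.
Context {R : realType} {n : nat}.
Implicit Types (s : seq 'M[R]_n) (x : nat -> 'cV[R]_n) (mu : R).

(** The coefficient of the [j]-th block in row [i] of [U + mu L]. *)
Definition stair mu (i j : nat) : R := if (j < i)%N then mu else 1.

(** Block [i] of [(U + mu L) x - mu x]. Indexing [x] by [nat] lets it be shifted and extended
    without a change of type. *)
Definition resid s mu x i : 'cV[R]_n :=
  \sum_(j < size s) stair mu i j *: (s`_j *m x j) - mu *: x i.

Lemma blockULE s mu :
  blockU s + mu *: blockL s =
  \mxblock_(i < size s, j < size s) (stair mu i j *: s`_j).
Proof.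
apply/matrixP => i j; rewrite !mxE /stair [in RHS]ltnNge.
by case: ltnP => _; rewrite !mxE ?mulr0 ?addr0 ?add0r ?mul1r.
Qed.

(** When [I - L] is invertible, the left side is [(I - L) (T - mu) x], written without the
    inverse. *)
Lemma blockUL_resid s mu x :
  blockU s *m (\mxcol_(i < size s) x i)
    - mu *: ((1%:M - blockL s) *m (\mxcol_(i < size s) x i)) =
  \mxcol_(i < size s) resid s mu x i.
Proof.
rewrite mulmxBl mul1mx scalerBr opprB addrA.
rewrite scalemxAl -mulmxDl blockULE mul_mxblock_mxrow.
apply/matrixP => i j; rewrite !mxE; congr (_ - _).
rewrite !summxE; apply: eq_bigr => k _.
by rewrite -scalemxAl.
Qed.

(** Forward substitution: block [i] of [V] is a nonnegative block plus the sum of [B_j V_j] over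
    [j < i]. *)
Lemma unit_lower_inv_ge0 s m (V : 'M[R]_(\sum_(i < size s) n, m)) :
  (forall j, nonneg_mx s`_j) ->
  mx_ge0 ((1%:M - blockL s) *m V) -> mx_ge0 V.
Proof.
move=> s0; rewrite -[V]submxcolK; set v := submxcol V.
rewrite mulmxBl mul1mx mul_mxblock_mxrow -mxcolB => /mxcol_ge0P h.
apply/mxcol_ge0P.
suff H k (i : 'I_(size s)) : (i < k)%N -> mx_ge0 (v i) by move=> i; exact: H (ltnSn i).
elim: k i => // k IH i ik a b; have := h i a b; rewrite !mxE subr_ge0; apply: le_trans.
rewrite summxE sumr_ge0 // => j _; case: ifP => ji; last by rewrite mul0mx mxE.
by apply: mx_ge0M; [exact: s0 | apply: IH; exact: leq_trans ji ik].
Qed.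

(** A kernel vector and its opposite are both nonnegative by forward substitution, so the kernel is
    0. *)
Lemma unit_lower_unitmx s :
  (forall j, nonneg_mx s`_j) -> 1%:M - blockL s \in unitmx.
Proof.
move=> s0; rewrite -unitmx_tr -row_free_unit; apply/inj_row_free => v vM.
have Mv : (1%:M - blockL s) *m v^T = 0 by rewrite -[LHS]trmxK trmx_mul trmxK vM trmx0.
have p : mx_ge0 v^T by apply: (unit_lower_inv_ge0 s0); rewrite Mv => i j; rewrite mxE.
have q : mx_ge0 (- v^T).
  by apply: (unit_lower_inv_ge0 s0); rewrite mulmxN Mv oppr0 => i j; rewrite mxE.
apply/rowP => j; apply/eqP; rewrite mxE eq_le.
by have := p j 0; have := q j 0; rewrite !mxE oppr_ge0 => -> ->.
Qed.

Lemma unit_lower_invmx_ge0 s :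
  (forall j, nonneg_mx s`_j) -> mx_ge0 (invmx (1%:M - blockL s)).
Proof.
move=> s0; apply: (unit_lower_inv_ge0 s0).
rewrite mulmxV ?unit_lower_unitmx // => i j.
by rewrite mxE; case: eqP.
Qed.

Lemma iteration_matrix_ge0 s :
  (forall j, nonneg_mx s`_j) -> mx_ge0 (iteration_matrix s).
Proof.
move=> s0; apply: mx_ge0M; first exact: unit_lower_invmx_ge0.
by move=> i j; rewrite mxE; case: ifP => _; rewrite ?mxE //; exact: s0.
Qed.

Lemma sum_dim_gt0 s : (0 < n)%N -> (0 < size s)%N -> (0 < \sum_(i < size s) n)%N.
Proof. by move=> n0 d0; rewrite sum_nat_const card_ord muln_gt0 d0. Qed.

(** With [v = u (I - L)^-1] one has [v U = rho u] and [u = v (I - L)]. Adding [rho v L] to the first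
    gives [v (U + rho L) = rho v]; pairing [v] with [U x - mu (I - L) x] gives the last identity. *)
Lemma iteration_left_perron s :
  (0 < n)%N -> (0 < size s)%N -> (forall j, nonneg_mx s`_j) ->
  let rho := spectral_radius (iteration_matrix s) in
  exists u v : 'I_(size s) -> 'rV[R]_n,
    [/\ (forall i, nonneg_row (u i)) /\ (exists i, u i != 0),
        forall i, nonneg_row (v i), exists i, v i != 0,
        forall j : 'I_(size s),
          \sum_(i < size s) stair rho i j *: (v i *m s`_j) = rho *: v j &
        forall mu x, (rho - mu) *: (\sum_(i < size s) u i *m x i) =
                     \sum_(i < size s) v i *m resid s mu x i].
Proof.
move=> n0 d0 s0 rho.
have [u [u0 un0 uT]] := perron_frobenius (sum_dim_gt0 n0 d0) (iteration_matrix_ge0 s0).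
pose v := u *m invmx (1%:M - blockL s).
have Lu := unit_lower_unitmx s0.
have uv : u = v *m (1%:M - blockL s) by rewrite /v mulmxKV.
have v0 : nonneg_row v by apply: nonneg_rowM => //; exact: unit_lower_invmx_ge0.
have vn0 : v != 0 by apply: contra un0 => /eqP v0'; rewrite uv v0' mul0mx.
have vU : v *m blockU s = rho *: u by rewrite -uT /v -mulmxA.
have rowE (w : 'rV[R]_(\sum_(i < size s) n)) : nonneg_row w -> w != 0 ->
    (forall i, nonneg_row (submxrow w i)) /\ exists i, submxrow w i != 0.
  move=> w0 wn0; split; first by move=> i a; rewrite mxE.
  apply/existsP; apply: contraNT wn0; rewrite negb_exists => /forallP h.
  rewrite -[w]submxrowK; apply/eqP/mxrowP => i; rewrite mxrowK.
  by move/eqP: (negbNE (h i)) => ->; apply/matrixP => a b; rewrite !mxE.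
have [ub ue] := rowE u u0 un0; have [vb ve] := rowE v v0 vn0.
exists (submxrow u), (submxrow v); split => //.
- move=> j.
  have : v *m (blockU s + rho *: blockL s) = rho *: v.
    rewrite mulmxDr vU -scalemxAr -scalerDr; congr (_ *: _).
    by rewrite uv mulmxBr mulmx1 subrK.
  rewrite blockULE -{1}[v]submxrowK mul_mxrow_mxblock.
  move=> /(congr1 (fun w => submxrow w j)).
  rewrite mxrowK => e; apply/rowP => a; have := congr1 (fun w : 'rV_n => w 0 a) e.
  rewrite !mxE => <-; rewrite !summxE; apply: eq_bigr => k _.
  by rewrite -scalemxAr.
- move=> mu x; rewrite -!mul_mxrow_mxcol !submxrowK -blockUL_resid.
rewrite mulmxBr mulmxA vU -scalemxAr mulmxA -uv scalerBl.
by rewrite -scalemxAl.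
Qed.

Lemma iteration_right_perron s :
  (0 < n)%N -> (0 < size s)%N -> (forall j, nonneg_mx s`_j) ->
  let rho := spectral_radius (iteration_matrix s) in
  exists x, [/\ forall i, mx_ge0 (x i), exists2 i, (i < size s)%N & x i != 0 &
    forall i, (i < size s)%N -> resid s rho x i = 0].
Proof.
move=> n0 d0 s0 rho.
have T0 : nonneg_mx (iteration_matrix s)^T.
  by move=> i j; rewrite mxE; exact: iteration_matrix_ge0.
have [z [z0 zn0]] := perron_frobenius (sum_dim_gt0 n0 d0) T0.
rewrite spectral_radius_tr -/rho => zT.
pose X := z^T; have TX : iteration_matrix s *m X = rho *: X.
  by rewrite -[LHS]trmxK trmx_mul /X trmxK zT linearZ.
(* Blocks outside the range are set to 0, so nonnegativity holds at every index. *)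
pose x k : 'cV[R]_n := if insub k is Some i then submxcol X i else 0.
have xE (i : 'I_(size s)) : x i = submxcol X i by rewrite /x valK.
have XE : X = \mxcol_(i < size s) x i.
  by rewrite -[X]submxcolK; apply: eq_mxcol => i; rewrite xE.
exists x; split.
- move=> i a b; rewrite /x; case: insubP => [j _ _|_]; last by rewrite mxE.
  by rewrite !mxE ord1; exact: z0.
- have : [exists i : 'I_(size s), x i != 0].
    apply: contraNT zn0; rewrite negb_exists => /forallP h.
    rewrite -[z]trmxK -/X XE trmx_eq0; apply/eqP.
    apply/mxcolP => i; rewrite mxcolK; move/eqP: (negbNE (h i)) => ->.
    by apply/matrixP => a b; rewrite !mxE.
  by case/existsP => i xi; exists i.
move=> i id; have := blockUL_resid s rho x; rewrite -XE.
have -> : blockU s *m X = (1%:M - blockL s) *m (iteration_matrix s *m X).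
  by rewrite /iteration_matrix -mulmxA mulKVmx ?unit_lower_unitmx.
rewrite TX -scalemxAr subrr => /(congr1 (fun w => submxcol w (Ordinal id))).
by rewrite mxcolK => <-; apply/matrixP => a b; rewrite !mxE.
Qed.

End Blocks.

(** * Comparison by residuals *)

Lemma nonneg_pos_mul_gt0 (R : realType) n (u : 'rV[R]_n) (x : 'cV[R]_n) :
  nonneg_row u -> u != 0 -> mx_gt0 x -> 0 < (u *m x) 0 0.
Proof.
move=> u0 un0 x0; rewrite mxE.
have [d d0 dx] := fin_pos_lower_bound (fun i => x0 i 0).
apply: (@lt_le_trans _ _ (\sum_i u 0 i * d)).
  by rewrite -mulr_suml mulr_gt0 // nonneg_row_sum_gt0.
by apply: ler_sum => i _; rewrite ler_wpM2l.
Qed.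

Section Comparison.
Context {R : realType} {n : nat}.
Implicit Types (s : seq 'M[R]_n) (x : nat -> 'cV[R]_n) (mu : R).

Lemma residE s mu x i a :
  resid s mu x i a 0 =
  \sum_(j < size s) \sum_b stair mu i j * (s`_j a b * x j b 0) - mu * x i a 0.
Proof.
rewrite /resid !mxE summxE; congr (_ - _); apply: eq_bigr => j _.
by rewrite !mxE mulr_sumr.
Qed.

Lemma stair_gt0 mu i j : 0 < mu -> 0 < stair mu i j.
Proof. by move=> mu0; rewrite /stair; case: ifP. Qed.

Lemma sum_nth_entry_neq0 (B : 'M[R]_n) s a b :
  \sum_(j < size s) s`_j = B -> B a b != 0 ->
  exists j : 'I_(size s), s`_j a b != 0.
Proof.
move=> <- Bab; apply/existsP; apply: contraNT Bab; rewrite negb_exists => /forallP h.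
by rewrite summxE big1 // => j _; apply/eqP; rewrite -[_ == _]negbK h.
Qed.

(** Since [rho > 0], a nonzero product of an entry of [B_j] and one of [x_j] feeds every block row
    ([up]). Hence all blocks have the same zero set ([swap]), and irreducibility forces it to be
    empty. *)
Lemma right_perron_gt0 (B : 'M[R]_n) s rho x :
  irreducible_mx B -> \sum_(j < size s) s`_j = B -> (forall j, nonneg_mx s`_j) ->
  0 < rho -> (forall i, mx_ge0 (x i)) -> (exists2 i, (i < size s)%N & x i != 0) ->
  (forall i, (i < size s)%N -> resid s rho x i = 0) ->
  forall i, (i < size s)%N -> mx_gt0 (x i).
Proof.
move=> irr sB s0 rho0 x0 [i0 i0d xi0] res.
have E i a : (i < size s)%N ->
    rho * x i a 0 = \sum_(j < size s) \sum_b stair rho i j * (s`_j a b * x j b 0).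
  by move=> id; apply/esym/eqP; rewrite -subr_eq0 -residE res // mxE.
have t0 i (j : 'I_(size s)) a b : 0 <= stair rho i j * (s`_j a b * x j b 0).
  rewrite mulr_ge0 ?(ltW (stair_gt0 _ _ rho0)) // mulr_ge0 //; first exact: s0.
  exact: x0.
have up i (j : 'I_(size s)) a b : (i < size s)%N -> s`_j a b != 0 -> x j b 0 != 0 ->
    x i a 0 != 0.
  move=> id sab xjb; apply/eqP => xia.
  have e := E i a id; rewrite xia mulr0 in e.
  have e1 := psumr_eq0P (fun j _ => sumr_ge0 _ (fun b _ => t0 i j a b))
    (esym e) (i := j) isT.
  have /eqP := psumr_eq0P (fun b _ => t0 i j a b) e1 (i := b) isT.
  by rewrite !mulf_eq0 (negPf sab) (negPf xjb) gt_eqF ?stair_gt0.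
have swap i i' a : (i < size s)%N -> (i' < size s)%N -> x i a 0 != 0 -> x i' a 0 != 0.
  move=> id i'd xia.
  suff /existsP[j /existsP[b /andP[sab xjb]]] :
      [exists j : 'I_(size s), exists b, (s`_j a b != 0) && (x j b 0 != 0)].
    exact: (up _ j _ b).
  apply: contraNT xia; rewrite negb_exists => /forallP h.
  rewrite -(mulrI_eq0 _ (mulfI (lt0r_neq0 rho0))) E // big1 // => j _.
  rewrite big1 // => b _; have := h j; rewrite negb_exists => /forallP/(_ b).
  by rewrite negb_and !negbK => /orP[] /eqP ->; rewrite ?mul0r ?mulr0.
pose S := [set a | x i0 a 0 == 0].
have ST : S != finset.setT.
  apply: contra xi0 => /eqP ST; apply/eqP/matrixP => a b.
  have : a \in S by rewrite ST finset.in_setT.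
  by rewrite finset.inE ord1 mxE => /eqP.
have S0 : S = finset.set0.
  apply/eqP; apply/negP => /negP Sn0.
  have [a [b [aS bS Bab]]] := irr S Sn0 ST.
  have [j sab] := sum_nth_entry_neq0 sB Bab.
  move: aS bS; rewrite !finset.inE => aS bS.
  by have := up i0 j a b i0d sab (swap _ _ _ i0d (ltn_ord j) bS); rewrite aS.
move=> i id a b; rewrite ord1 lt_def x0 andbT; apply: (swap i0) => //.
by apply/negP => h; have := finset.in_set0 a; rewrite -S0 finset.inE h.
Qed.

(** Only the sum is positive in general: [v_j] vanishes on the zero columns of [B_j]. An edge of [B]
    leaving the support of the sum lies in some [B_j] and makes [v_j] nonzero outside that
    support. *)
Lemma left_perron_gt0 (B : 'M[R]_n) s rho (v : 'I_(size s) -> 'rV[R]_n) :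
  irreducible_mx B -> \sum_(j < size s) s`_j = B -> (forall j, nonneg_mx s`_j) ->
  0 < rho -> (forall i, nonneg_row (v i)) -> (exists i, v i != 0) ->
  (forall j : 'I_(size s),
     \sum_(i < size s) stair rho i j *: (v i *m s`_j) = rho *: v j) ->
  forall a, 0 < (\sum_i v i) 0 a.
Proof.
move=> irr sB s0 rho0 v0 [i0 vi0] ev.
have w0 a : 0 <= (\sum_i v i) 0 a by rewrite summxE sumr_ge0 // => i _; exact: v0.
pose S := [set a | (\sum_i v i) 0 a != 0].
have wS i a : v i 0 a != 0 -> a \in S.
  rewrite finset.inE summxE => via; rewrite gt_eqF // (bigD1 i) //=.
  apply: ltr_wpDr; first by rewrite sumr_ge0 // => k _; exact: v0.
  by rewrite lt_def via v0.
have S0 : S != finset.set0.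
  apply: contra vi0 => /eqP S0; apply/eqP/rowP => a; rewrite mxE; apply/eqP.
  by apply/negPn/negP => /wS; rewrite S0 finset.in_set0.
suff ST : S = finset.setT.
  move=> a; have : a \in S by rewrite ST finset.in_setT.
  by rewrite finset.inE lt_def w0 andbT.
apply/eqP; apply/negPn/negP => ST.
have [a [b [aS bS Bab]]] := irr S S0 ST.
have [j sab] := sum_nth_entry_neq0 sB Bab.
have /existsP[i via] : [exists i, v i 0 a != 0].
  move: aS; rewrite finset.inE; apply: contraNT; rewrite negb_exists => /forallP h.
  by rewrite summxE big1 // => i _; apply/eqP; rewrite -[_ == _]negbK h.
move/negP: bS; apply; apply: (wS j).
have e : \sum_(i < size s) \sum_a stair rho i j * (v i 0 a * s`_j a b) = rho * v j 0 b.
  have := congr1 (fun w : 'rV[R]_n => w 0 b) (ev j); rewrite [in RHS]mxE => <-.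
  by rewrite summxE; apply: eq_bigr => k _; rewrite !mxE mulr_sumr.
have t0 (k : 'I_(size s)) c : 0 <= stair rho k j * (v k 0 c * s`_j c b).
  rewrite mulr_ge0 ?(ltW (stair_gt0 _ _ rho0)) // mulr_ge0 //; first exact: v0.
  exact: s0.
apply/eqP => vjb; rewrite vjb mulr0 in e.
have e1 := psumr_eq0P (fun k _ => sumr_ge0 _ (fun c _ => t0 k c)) e (i := i) isT.
have /eqP := psumr_eq0P (fun c _ => t0 i c) e1 (i := a) isT.
by rewrite !mulf_eq0 (negPf sab) (negPf via) gt_eqF ?stair_gt0.
Qed.

Lemma compare_resid s mu x :
  (0 < n)%N -> (0 < size s)%N -> (forall j, nonneg_mx s`_j) ->
  (forall i, (i < size s)%N -> mx_gt0 (x i)) ->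
  exists2 c : R, 0 < c & exists2 v : 'I_(size s) -> 'rV[R]_n,
    forall i, nonneg_row (v i) &
    (spectral_radius (iteration_matrix s) - mu) * c =
      \sum_(i < size s) (v i *m resid s mu x i) 0 0.
Proof.
move=> n0 d0 s0 x0.
have [u [v [[u0 [i ui]] v0 _ _ id]]] := iteration_left_perron n0 d0 s0.
exists ((\sum_(i < size s) u i *m x i) 0 0).
  rewrite summxE (bigD1 i) //=; apply: ltr_wpDr.
    apply: sumr_ge0 => k _; rewrite mxE sumr_ge0 // => a _.
    by rewrite mulr_ge0 ?u0 // ltW // x0.
  exact: nonneg_pos_mul_gt0 (u0 i) ui (x0 _ (ltn_ord i)).
exists v => //; have := congr1 (fun w : 'M[R]_1 => w 0 0) (id mu x).
by rewrite [in LHS]mxE => ->; rewrite summxE.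
Qed.

Lemma spectral_radius_le s mu x :
  (0 < n)%N -> (0 < size s)%N -> (forall j, nonneg_mx s`_j) ->
  (forall i, (i < size s)%N -> mx_gt0 (x i)) ->
  (forall i a, (i < size s)%N -> resid s mu x i a 0 <= 0) ->
  spectral_radius (iteration_matrix s) <= mu.
Proof.
move=> n0 d0 s0 x0 r0; have [c c0 [v v0 e]] := compare_resid mu n0 d0 s0 x0.
rewrite -subr_le0 -(pmulr_lle0 _ c0) e -oppr_ge0 -sumrN sumr_ge0 // => i _.
rewrite mxE -sumrN sumr_ge0 // => a _.
by rewrite -mulrN mulr_ge0 ?v0 // oppr_ge0 r0.
Qed.

Lemma spectral_radius_ge s mu x :
  (0 < n)%N -> (0 < size s)%N -> (forall j, nonneg_mx s`_j) ->
  (forall i, (i < size s)%N -> mx_gt0 (x i)) ->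
  (forall i a, (i < size s)%N -> 0 <= resid s mu x i a 0) ->
  mu <= spectral_radius (iteration_matrix s).
Proof.
move=> n0 d0 s0 x0 r0; have [c c0 [v v0 e]] := compare_resid mu n0 d0 s0 x0.
rewrite -subr_ge0 -(pmulr_lge0 _ c0) e sumr_ge0 // => i _.
by rewrite mxE sumr_ge0 // => a _; rewrite mulr_ge0 ?v0 // r0.
Qed.

(** A residual common to all blocks factors out and leaves the positive row [sum_i v_i]. As [x] is
    merely nonnegative, [c] may be 0 a priori; strictness will come from the right side. *)
Lemma compare_uniform_resid (B : 'M[R]_n) s mu x r :
  irreducible_mx B -> \sum_(j < size s) s`_j = B ->
  (0 < n)%N -> (0 < size s)%N -> (forall j, nonneg_mx s`_j) ->
  0 < spectral_radius (iteration_matrix s) ->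
  (forall i, (i < size s)%N -> mx_ge0 (x i)) ->
  (forall i, (i < size s)%N -> resid s mu x i = r) ->
  exists2 c : R, 0 <= c & exists2 w : 'rV[R]_n, forall a, 0 < w 0 a &
    (spectral_radius (iteration_matrix s) - mu) * c = (w *m r) 0 0.
Proof.
move=> irr sB n0 d0 s0 rho0 x0 xr.
have [u [v [[u0 _] v0 vn0 ev id]]] := iteration_left_perron n0 d0 s0.
exists ((\sum_(i < size s) u i *m x i) 0 0).
  rewrite summxE; apply: sumr_ge0 => k _; rewrite mxE sumr_ge0 // => a _.
  by rewrite mulr_ge0 ?u0 // x0.
exists (\sum_i v i); first exact: left_perron_gt0 irr sB s0 rho0 v0 vn0 ev.
have := congr1 (fun w : 'M[R]_1 => w 0 0) (id mu x).
rewrite [in LHS]mxE => ->; congr (fun_of_matrix _ 0 0).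
by rewrite mulmx_suml; apply: eq_bigr => i _; rewrite xr.
Qed.

End Comparison.

(** * Cyclic shifts and refinements *)

Section Refinement.
Context {R : realType} {n : nat}.
Implicit Types (s C : seq 'M[R]_n) (x : nat -> 'cV[R]_n) (mu : R).

(** A positive eigenvector of [T], stated through residuals. Its existence determines the spectral
    radius and passes to cyclic shifts, so different iteration matrices are never compared
    directly. *)
Definition positive_solution s mu :=
  exists x, (forall i, (i < size s)%N -> mx_gt0 (x i)) /\
            (forall i, (i < size s)%N -> resid s mu x i = 0).

Lemma positive_solution_spectral_radius s mu :
  (0 < n)%N -> (0 < size s)%N -> (forall j, nonneg_mx s`_j) ->
  positive_solution s mu -> spectral_radius (iteration_matrix s) = mu.
Proof.
move=> n0 d0 s0 [x [x0 xr]]; apply/eqP; rewrite eq_le; apply/andP; split.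
  by apply: (spectral_radius_le n0 d0 s0 x0) => i a id; rewrite xr // mxE.
by apply: (spectral_radius_ge n0 d0 s0 x0) => i a id; rewrite xr // mxE.
Qed.

Lemma positive_solution_ex (B : 'M[R]_n) s :
  irreducible_mx B -> \sum_(j < size s) s`_j = B ->
  (0 < n)%N -> (0 < size s)%N -> (forall j, nonneg_mx s`_j) ->
  0 < spectral_radius (iteration_matrix s) ->
  positive_solution s (spectral_radius (iteration_matrix s)).
Proof.
move=> irr sB n0 d0 s0 rho0.
have [x [x0 xn0 xr]] := iteration_right_perron n0 d0 s0.
by exists x; split => //; exact: right_perron_gt0 irr sB s0 rho0 x0 xn0 xr.
Qed.

(* If (x_1, ..., x_d) solves the system for (B_1, ..., B_d), then
   (x_d / mu, x_1, ..., x_{d-1}) solves it for (B_d, B_1, ..., B_{d-1}). *)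
Lemma positive_solution_cshift s mu :
  0 < mu -> positive_solution s mu -> positive_solution (cshift s) mu.
Proof.
case/lastP: s => [|s z] mu0 [x [x0 xr]]; first by exists x.
rewrite /cshift rotr1_rcons size_rcons in x0 xr *.
have last_term i : \sum_(j < (size s).+1) stair mu i j *: ((rcons s z)`_j *m x j) =
    \sum_(j < size s) stair mu i j *: (s`_j *m x j) +
      stair mu i (size s) *: (z *m x (size s)).
  rewrite big_ord_recr /= nth_rcons ltnn eqxx; congr (_ + _).
  by apply: eq_bigr => j _; rewrite nth_rcons ltn_ord.
exists (fun k => if k is k'.+1 then x k' else mu^-1 *: x (size s)); split.
  case=> [|i] id a b; last exact: (x0 i (ltnW id)).
  by rewrite mxE mulr_gt0 ?invr_gt0 // x0.
have munz : mu != 0 by rewrite gt_eqF.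
(* Row 0 is the old last row divided by [mu]; row [i.+1] is the old row [i], the factor [mu] on [z]
   cancelling [mu^-1]. *)
case=> [|i] id; rewrite /resid /= big_ord_recl /=.
  transitivity (mu^-1 *: resid (rcons s z) mu x (size s)); last first.
    by rewrite xr ?scaler0.
  rewrite /resid size_rcons last_term.
  rewrite !scalerBr !scalerDr !scalerA mulVf // mulfV // !scale1r.
  congr (_ - _); rewrite addrC; congr (_ + _); last first.
    by rewrite /stair ltnn scalemxAr mulr1.
  rewrite scaler_sumr; apply: eq_bigr => j _.
  by rewrite /stair ltn_ord scalerA mulVf.
transitivity (resid (rcons s z) mu x i); last exact/xr/ltnW.
rewrite /resid size_rcons last_term.
congr (_ - _); rewrite addrC; congr (_ + _).
rewrite /stair /= -scalemxAr scalerA mulfV //.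
by rewrite ltnNge (ltnW (id : (i < size s)%N)).
Qed.

Lemma positive_solution_iter_cshift s mu r :
  0 < mu -> positive_solution s mu -> positive_solution (iter r (@cshift R n) s) mu.
Proof. by move=> mu0 h; elim: r => //= r IH; exact: positive_solution_cshift. Qed.

Lemma perm_iter_cshift s r : perm_eq (iter r (@cshift R n) s) s.
Proof. by elim: r => //= r IH; rewrite /cshift perm_rotr. Qed.

Lemma nonneg_nthP s :
  (forall j, nonneg_mx s`_j) <-> (forall M, M \in s -> nonneg_mx M).
Proof.
split=> [s0 M /(nthP 0)[j _ <-] // | s0 j].
have [jd|jd] := ltnP j (size s); first exact/s0/mem_nth.
by rewrite nth_default // => a b; rewrite mxE.
Qed.

Lemma nonneg_iter_cshift s r : (forall j, nonneg_mx s`_j) ->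
  forall j, nonneg_mx (iter r (@cshift R n) s)`_j.
Proof.
move=> /nonneg_nthP s0; apply/nonneg_nthP => M.
by rewrite (perm_mem (perm_iter_cshift s r)); exact: s0.
Qed.

Lemma sum_nthE s : \sum_(j < size s) s`_j = \sum_(M <- s) M.
Proof. by rewrite (big_nth 0) big_mkord. Qed.

(** Disjoint supports make each nonzero entry of a part equal to the entry of [B]. *)
Lemma splitting_nonneg (B : 'M[R]_n) s :
  nonneg_mx B -> splitting B s -> forall j, nonneg_mx s`_j.
Proof.
move=> B0 [_ sB had] j a b.
have [jd|jd] := ltnP j (size s); last by rewrite nth_default // mxE.
have [->//|sab] := eqVneq (s`_j a b) 0.
suff -> : s`_j a b = B a b by [].
rewrite -sB -sum_nthE summxE (bigD1 (Ordinal jd)) //= big1 ?addr0 // => k kj.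
have := congr1 (fun M : 'M_n => M a b) (had k j (ltn_ord k) jd kj).
by rewrite !mxE => /eqP; rewrite mulf_eq0 (negPf sab) orbF => /eqP.
Qed.

(** Write [E], [F] for blocks [k], [k.+1] of [C']. In rows up to [k], passing from [F x_k] to
    [F x'_(k+1)] adds [(1 - 1/mu) F E x_k]. In the new last row [E] has coefficient [mu], and the
    extra [(mu - 1) E x_k] is cancelled by [mu x'_(k+1) = mu x_k + (mu - 1) E x_k]. *)
Lemma refined_resid C C' k mu x :
  size C = k.+1 -> size C' = k.+2 ->
  (forall p, (p < k)%N -> C'`_p = C`_p) -> C`_k = C'`_k + C'`_k.+1 ->
  mu != 0 -> (forall i, (i < k.+1)%N -> resid C mu x i = 0) ->
  let x' i := if (i <= k)%N then x i else x k + (1 - mu^-1) *: (C'`_k *m x k) in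
  forall i, (i < k.+2)%N ->
    resid C' mu x' i = (1 - mu^-1) *: (C'`_k.+1 *m C'`_k *m x k).
Proof.
move=> sC sC' CC' CE mu0 xr x' i ik.
have common m : \sum_(j < k) stair mu m j *: (C'`_j *m x' j) =
                \sum_(j < k) stair mu m j *: (C`_j *m x j).
  by apply: eq_bigr => j _; rewrite CC' // /x' ltnW.
have xk : x' k = x k by rewrite /x' leqnn.
have xk1 : x' k.+1 = x k + (1 - mu^-1) *: (C'`_k *m x k) by rewrite /x' ltnn.
have split_res m : (m <= k)%N -> mu *: x m =
    \sum_(j < k) stair mu m j *: (C`_j *m x j) + C'`_k *m x k + C'`_k.+1 *m x k.
  move=> mk; have := xr m mk; rewrite /resid sC big_ord_recr /= => /eqP.
  rewrite subr_eq0 => /eqP <-; rewrite CE mulmxDl /stair ltnNge mk /= scale1r.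
  by rewrite addrA.
rewrite /resid sC' big_ord_recr big_ord_recr /= common xk xk1.
have mE : mu * (1 - mu^-1) = mu - 1 by rewrite mulrBr mulr1 mulfV.
have stair_k1 : stair mu i k.+1 = 1 by rewrite /stair ltnNge -ltnS ik.
rewrite stair_k1 scale1r mulmxDr -scalemxAr mulmxA.
have [ik'|ki] := leqP i k.
  rewrite /x' ik' split_res // /stair (ltnNge k i) ik' /= scale1r.
  by rewrite addrA [_ - (_ + _)]addrAC subrr add0r.
have {ik ki} -> : i = k.+1 by apply/eqP; rewrite eqn_leq -ltnS ik ki.
rewrite xk1 scalerDr split_res // scalerA mE scalerBl scale1r /stair ltnSn.
have -> : \sum_(j < k) (if (j < k.+1)%N then mu else 1) *: (C`_j *m x j) =
          \sum_(j < k) (if (j < k)%N then mu else 1) *: (C`_j *m x j).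
  by apply: eq_bigr => j _; rewrite ltn_ord ltnS ltnW.
set S := \sum_(j < k) _; set P := C'`_k *m x k; set Q := C'`_k.+1 *m x k.
have -> : S + P + Q + (mu - 1) *: P = S + mu *: P + Q.
  by rewrite scalerBl scale1r (addrAC S P Q) [_ - P]addrC addrA addrK addrAC.
by rewrite addrA [X in X - _]addrC addrK.
Qed.

End Refinement.

(** * Bounds by the spectral radius of the unsplit matrix, and strict comparison *)

Lemma spectral_radius_gt0_dim (R : realType) n (B : 'M[R]_n) :
  0 < spectral_radius B -> (0 < n)%N.
Proof.
case: n B => // B; rewrite /spectral_radius.
set E := [set r : R | _]%classic; suff -> : E = set0 by rewrite sup0 ltxx.
apply/seteqP; split=> // r [l [/eigenvalueP [v _ vn0] _]].
by move: vn0; rewrite [v]thinmx0 eqxx.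
Qed.

(** For the one-block sequence the residual is [B y - mu y], so positivity of block eigenvectors
    applies. *)
Lemma irreducible_perron (R : realType) n (B : 'M[R]_n) :
  irreducible_mx B -> nonneg_mx B -> 0 < spectral_radius B ->
  exists2 y : 'cV[R]_n, mx_gt0 y & B *m y = spectral_radius B *: y.
Proof.
move=> irr B0 rho0; have n0 := spectral_radius_gt0_dim rho0.
have BT0 : nonneg_mx B^T by move=> i j; rewrite mxE; exact: B0.
have [z [z0 zn0]] := perron_frobenius n0 BT0; rewrite spectral_radius_tr => zB.
have By : B *m z^T = spectral_radius B *: z^T.
  by rewrite -[LHS]trmxK trmx_mul trmxK zB linearZ.
exists z^T => //.
have s0 : forall j, nonneg_mx [:: B]`_j.
  by apply/nonneg_nthP => M; rewrite inE => /eqP ->.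
have sB : \sum_(j < size [:: B]) [:: B]`_j = B by rewrite sum_nthE big_seq1.
have x0 (i : nat) : mx_ge0 z^T by move=> a b; rewrite mxE ord1; exact: z0.
apply: (right_perron_gt0 (x := fun=> z^T) irr sB s0 rho0 x0 _ _ (ltnSn 0)).
  by exists 0; rewrite ?trmx_eq0.
case=> // _; rewrite /resid big_ord_recl big_ord0 addr0 /= /stair ltnn scale1r.
by rewrite By subrr.
Qed.

Section Main.
Context {R : realType} {n : nat} (B : 'M[R]_n).
Context (irr : irreducible_mx B) (B0 : nonneg_mx B)
        (rho0 : 0 < spectral_radius B).
Implicit Types (s C : seq 'M[R]_n) (w : nat -> R).
Local Notation rho := (spectral_radius B).

Let n0 : (0 < n)%N := spectral_radius_gt0_dim rho0.

(** Writing [y] as the sum of the [B_j y / rho] spreads the diagonal term over the blocks, so signs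
    can be read off the scalar coefficients. *)
Lemma weighted_perron_resid s (y : 'cV[R]_n) w mu i :
  \sum_(j < size s) s`_j = B -> B *m y = rho *: y ->
  resid s mu (fun j => w j *: y) i =
  \sum_(j < size s) (stair mu i j * w j - mu * w i / rho) *: (s`_j *m y).
Proof.
move=> sB By; under [RHS]eq_bigr do rewrite scalerBl.
rewrite sumrB -scaler_sumr -mulmx_suml sB By !scalerA divfK ?gt_eqF //.
rewrite /resid scalerA; congr (_ - _); apply: eq_bigr => j _.
by rewrite -scalemxAr scalerA.
Qed.

Lemma iteration_radius_bounds s :
  (0 < size s)%N -> splitting B s ->
  [/\ 0 < spectral_radius (iteration_matrix s),
      rho < 1 -> spectral_radius (iteration_matrix s) <= rho,
      rho = 1 -> spectral_radius (iteration_matrix s) = 1 &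
      1 < rho -> rho <= spectral_radius (iteration_matrix s)].
Proof.
move=> d0 sp; have s0 := splitting_nonneg B0 sp.
have sB : \sum_(j < size s) s`_j = B by rewrite sum_nthE; case: sp.
have [y y0 By] := irreducible_perron irr B0 rho0.
have W w mu i a : resid s mu (fun j => w j *: y) i a 0 =
    \sum_(j < size s) (stair mu i j * w j - mu * w i / rho) * (s`_j *m y) a 0.
  rewrite (weighted_perron_resid w mu i sB By) summxE.
  by apply: eq_bigr => j _; rewrite mxE.
have y1 (i : nat) : (i < size s)%N -> mx_gt0 (1 *: y).
  by move=> _; rewrite scale1r.
have sy j a : 0 <= (s`_j *m y) a 0.
  by apply: mx_ge0M => [|c e]; [exact: s0 | exact: ltW].
(* With unit weights and [mu = rho] the coefficients are [rho - 1] for [j < i] and 0 otherwise. *)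
have up : rho <= 1 -> spectral_radius (iteration_matrix s) <= rho.
  move=> r1; apply: (spectral_radius_le n0 d0 s0 y1) => i a _; rewrite W.
  rewrite -oppr_ge0 -sumrN sumr_ge0 // => j _.
  rewrite -mulNr mulr_ge0 // !mulr1 divff ?gt_eqF // opprB subr_ge0 /stair.
  by case: ifP.
have lo : 1 <= rho -> rho <= spectral_radius (iteration_matrix s).
  move=> r1; apply: (spectral_radius_ge n0 d0 s0 y1) => i a _; rewrite W.
  rewrite sumr_ge0 // => j _.
  rewrite mulr_ge0 // !mulr1 divff ?gt_eqF // subr_ge0 /stair.
  by case: ifP.
split => //.
- have [le1|/ltW/lo] := leP rho 1; last exact: lt_le_trans.
  (* Positivity for [rho <= 1]: with [mu = rho^d] and weights [rho^j], the exponents [d + j] (for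
     [j < i]) and [j] (for [j >= i]) are at most [d - 1 + i]. *)
  apply: (@lt_le_trans _ _ (rho ^+ size s)); first exact: exprn_gt0.
  apply: (@spectral_radius_ge _ _ _ _ (fun j => rho ^+ j *: y) n0 d0 s0).
    by move=> i _ a b; rewrite mxE mulr_gt0 // exprn_gt0.
  move=> i a id; rewrite W sumr_ge0 // => j _; rewrite mulr_ge0 // subr_ge0.
  have -> : rho ^+ size s * rho ^+ i / rho = rho ^+ ((size s).-1 + i).
    by rewrite exprD -{1}(prednK d0) exprS -(mulrA rho) mulrC mulKf ?gt_eqF.
  have jd := ltn_ord j; rewrite /stair.
  case: ifP => ji; rewrite ?mul1r -?exprD; apply: (ler_wiXn2l (ltW rho0) le1).
    by rewrite -{1}(prednK d0) addSnnS leq_add2l.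
  by apply: leq_trans (leq_addr _ _); rewrite -ltnS prednK.
- by move=> /ltW.
- by move=> r1; apply/eqP; rewrite eq_le -{1}r1 up ?r1 // -{1}r1 lo ?r1.
- by move=> /ltW.
Qed.

Lemma refinement_strict s s' :
  (0 < size s)%N -> size s' = (size s).+1 -> splitting B s -> splitting B s' ->
  refines s' s ->
  let lambda := spectral_radius (iteration_matrix s) in
  let lambda' := spectral_radius (iteration_matrix s') in
  (lambda < 1 -> lambda' < lambda) /\ (1 < lambda -> lambda < lambda').
Proof.
move=> d0 sz sp sp' [r [t [_ _ h]]] lam lam'.
move: h; set C := iter r _ s; set C' := iter t _ s' => -[CC' [_ CE _] FE].
have s0 := splitting_nonneg B0 sp; have s0' := splitting_nonneg B0 sp'.
have d0' : (0 < size s')%N by rewrite sz.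
have sumB u : splitting B u -> \sum_(j < size u) u`_j = B.
  by case=> _ uB _; rewrite sum_nthE.
have [lam0 _ _ _] := iteration_radius_bounds d0 sp.
have [lam'0 _ _ _] := iteration_radius_bounds d0' sp'.
have C'0 := nonneg_iter_cshift t s0'; rewrite -/C' in C'0.
have sC : size C = size s := perm_size (perm_iter_cshift s r).
have sC' : size C' = (size s).+1 by rewrite (perm_size (perm_iter_cshift s' t)).
have C'B : \sum_(j < size C') C'`_j = B.
  by rewrite sum_nthE (perm_big _ (perm_iter_cshift s' t)) -sum_nthE sumB.
(* The shifted splitting has the same radius because a positive solution is carried along. *)
have lamC' : spectral_radius (iteration_matrix C') = lam'.
  apply: positive_solution_spectral_radius => //; first by rewrite sC'.
  apply: positive_solution_iter_cshift => //.
  exact: positive_solution_ex irr (sumB _ sp') n0 d0' s0' lam'0.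
have [x [x0 xr]] : positive_solution C lam.
  apply: positive_solution_iter_cshift => //.
  exact: positive_solution_ex irr (sumB _ sp) n0 d0 s0 lam0.
case E : (size s) d0 => [//|k] _; rewrite E /= in sC sC' CC' CE FE.
rewrite sC in x0 xr.
rewrite !big_cons big_nil addr0 in CE.
have lamn0 : lam != 0 by rewrite gt_eqF.
have xr' := refined_resid sC sC' CC' (esym CE) lamn0 xr.
pose x' i := if (i <= k)%N then x i else x k + (1 - lam^-1) *: (C'`_k *m x k).
have C0 := nonneg_iter_cshift r s0; rewrite -/C in C0.
(* For [lam < 1] the factor [1 - lam^-1] is negative; multiplying by [lam] and inserting row [k] of
   the system leaves only nonnegative terms. *)
have last_ge0 : mx_ge0 (x k + (1 - lam^-1) *: (C'`_k *m x k)).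
  have e : lam *: (x k + (1 - lam^-1) *: (C'`_k *m x k)) =
      \sum_(j < k) lam *: (C`_j *m x j) + C'`_k.+1 *m x k + lam *: (C'`_k *m x k).
    have := xr k (ltnSn k); rewrite /resid sC big_ord_recr /= => /eqP.
    rewrite subr_eq0 => /eqP lx; rewrite scalerDr -lx scalerA mulrBr mulr1.
    rewrite mulfV // scalerBl scale1r -CE mulmxDl /stair ltnn scale1r.
    under eq_bigr do rewrite ltn_ord.
    set S := \sum_(j < k) _; set P := C'`_k *m x k; set Q := C'`_k.+1 *m x k.
    rewrite (addrC P Q) (addrA S) -(addrA (S + Q)) (addrC (lam *: P)).
    by rewrite (addrA P) subrr add0r.
  move=> a b; rewrite -(pmulr_rge0 _ lam0).
  have := congr1 (fun M : 'cV[R]_n => M a b) e; rewrite [in LHS]mxE => ->.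
  have t0 (M : 'M[R]_n) j : (j < k.+1)%N -> nonneg_mx M -> 0 <= (M *m x j) a b.
    by move=> jk M0; apply: mx_ge0M => // c f; rewrite ltW // x0.
  rewrite !mxE summxE !addr_ge0 //; first 1 last.
  - by have := t0 _ k (ltnSn k) (C'0 k.+1); rewrite mxE.
  - by have := t0 _ k (ltnSn k) (C'0 k); rewrite mxE => h; rewrite mulr_ge0 // ltW.
  rewrite sumr_ge0 // => j _; rewrite mxE mulr_ge0 ?(ltW lam0) //.
  by apply: t0 => //; rewrite ltnS ltnW.
have x'0 i : (i < size C')%N -> mx_ge0 (x' i).
  by move=> _; rewrite /x'; case: leqP => // ik a b; rewrite ltW // x0.
have rr i : (i < size C')%N ->
    resid C' lam x' i = (1 - lam^-1) *: (C'`_k.+1 *m C'`_k *m x k).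
  by rewrite sC'; exact: xr'.
have C'd : (0 < size C')%N by rewrite sC'.
have lamC'0 : 0 < spectral_radius (iteration_matrix C') by rewrite lamC'.
have [c c0 [w w0]] := compare_uniform_resid irr C'B n0 C'd C'0 lamC'0 x'0 rr.
rewrite lamC' -scalemxAr mxE => e.
(* A positive row times the nonzero nonnegative matrix [F E] is nonzero and nonnegative, and [x k]
   is positive. *)
have p0 : 0 < (w *m (C'`_k.+1 *m C'`_k *m x k)) 0 0.
  rewrite mulmxA; apply: nonneg_pos_mul_gt0; last exact: x0.
    apply: nonneg_rowM => [a|]; first exact: ltW.
    by apply: mx_ge0M; exact: C'0.
  apply: contra FE => /eqP/rowP h; apply/eqP/matrixP => a b; rewrite [RHS]mxE.
  have G0 : mx_ge0 (C'`_k.+1 *m C'`_k) by apply: mx_ge0M; exact: C'0.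
  have := h b; rewrite mxE [RHS]mxE => hb.
  have /eqP := psumr_eq0P (fun c _ => mulr_ge0 (ltW (w0 c)) (G0 c b)) hb (i := a) isT.
  by rewrite mulf_eq0 gt_eqF // => /eqP.
(* Now [(lam' - lam) c] equals [1 - lam^-1] times a positive number; with [c >= 0], the opposite
   order of [lam] and [lam'] would give the wrong sign. *)
split=> l1.
- rewrite ltNge; apply/negP => ll.
  have : 0 <= (lam' - lam) * c by rewrite mulr_ge0 // subr_ge0.
  by rewrite e pmulr_lge0 // subr_ge0 invf_le1 // leNgt l1.
- rewrite ltNge; apply/negP => ll.
  have : (lam' - lam) * c <= 0 by rewrite mulr_le0_ge0 // subr_le0.
  by rewrite e pmulr_lle0 // subr_le0 invf_ge1 // leNgt l1.
Qed.

End Main.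

Theorem theorem3p2 (R : realType) (n : nat) (BJ : 'M[R]_n)
    (s s' : seq 'M[R]_n) :
  irreducible_mx BJ -> nonneg_mx BJ -> 0 < spectral_radius BJ ->
  (1 <= size s)%N -> size s' = (size s).+1 ->
  splitting BJ s -> splitting BJ s' -> refines s' s ->
  [/\ spectral_radius BJ < 1 ->
        spectral_radius (iteration_matrix s') < spectral_radius (iteration_matrix s)
        /\ spectral_radius (iteration_matrix s) <= spectral_radius BJ,
      spectral_radius BJ = 1 ->
        spectral_radius (iteration_matrix s') = 1
        /\ spectral_radius (iteration_matrix s) = 1 &
      1 < spectral_radius BJ ->
        spectral_radius (iteration_matrix s') > spectral_radius (iteration_matrix s)
        /\ spectral_radius (iteration_matrix s) >= spectral_radius BJ].
Proof.
move=> irr B0 rho0 d0 sz sp sp' ref.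
have d0' : (0 < size s')%N by rewrite sz.
have [_ le1 eq1 ge1] := iteration_radius_bounds irr B0 rho0 d0 sp.
have [_ _ eq1' _] := iteration_radius_bounds irr B0 rho0 d0' sp'.
have [lt gt] := refinement_strict irr B0 rho0 d0 sz sp sp' ref.
(* The bounds put the radius of the coarser splitting on the same side of 1 as that of [BJ], as the
   strict comparison requires. *)
split=> r1.
- by split; [apply: lt; exact: le_lt_trans (le1 r1) r1 | exact: le1].
- by rewrite eq1 // eq1'.
- by split; [apply: gt; exact: lt_le_trans r1 (ge1 r1) | exact: ge1].
Qed.
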